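(* Let $f,m,N,\varpi,a_0,a_\phi$ be smooth real functions of $R$ on an open interval on which $R,f,m,N>0$, let $g$ be the five-dimensional metric and $A$ the vector potential built from them as in the context, and let $'=\frac{d}{dR}$. Then: (i) $(g,A)$ satisfies the Einstein--Maxwell equations (in the normalization of the context) if and only if there are constants $\hat Q,\hat J$ such that all of the following hold. First, the conservation laws $$N''=2,\qquad \frac{N}{f}\,(a_0'+\varpi a_\phi')=-\hat Q,\qquad \frac{N^2}{f m}\,\varpi'+4\hat Q a_\phi=-2\hat J .$$ Second, the equations $$f^2 m\Big(\frac{m}{f^2}f'\Big)'-m m'\Big(\frac{m'}{m}-2\frac{N'}{N}\Big)f-\Big(4\frac{m^2}{N}-f\Big)f=\frac83\frac{f m}{N}\big(2m^2(a_\phi')^2-f a_\phi^2\big)-\frac{4\hat Q^2}{3}\frac{f^2m^2}{N^2},$$ $$f m\Big(\frac{N}{m}m'\Big)'+\Big(\frac{f^2N}{m^2}-2f\Big)m=\frac43 f\big(2m^2(a_\phi')^2-f a_\phi^2\big)+\frac{4\hat Q^2}{3}\frac{f^2m}{N}+4\frac{f^2m^2}{N^2}(\hat J+2\hat Q a_\phi)^2,$$ $$m\,(m a_\phi')'-f a_\phi=2\hat Q\frac{f m^2}{N^2}(\hat J+2\hat Q a_\phi).$$ Third, the constraint $\mathsf C=0$, where $$\mathsf C= m^2(a_\phi')^2-\Big[f a_\phi^2-m+\frac{fN}{4m}+\hat Q^2\frac{f m}{N}+\frac{f m^2}{N^2}(\hat J+2\hat Q a_\phi)^2+\frac{N m'}{8}\Big(\frac{f'}{f}-2\frac{m'}{m}+4\frac{N'}{N}\Big)-\frac{N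 m f'}{8f}\Big(2\frac{f'}{f}-\frac{m'}{m}+2\frac{N'}{N}\Big)\Big].$$ (ii) If $N=(R-r_+^2)(R-r_-^2)$ with $r_\pm^2$ constants (the general solution of $N''=2$), and $(f,m,a_\phi)$ satisfies the three second-order equations in (i) for some constants $\hat Q,\hat J$, then $(\mathsf C/f^2)'=0$.
   Context: Coordinates are $(t,R,\theta,\phi,\psi)$ with $R=r^2$ and $0<\theta<\pi/2$. Given functions $f,m,N,\varpi,a_0,a_\phi$ of $R$ only, the ansatz is $$ds^2=-f\,dt^2+\frac{m}{f}\Big(\frac{dR^2}{4N}+d\theta^2\Big)+\frac{N}{m}\Big[\sin^2\theta\,(d\phi-\varpi\,dt)^2+\cos^2\theta\,(d\psi-\varpi\,dt)^2\Big]+\frac{m^2-fN}{m f}\sin^2\theta\cos^2\theta\,(d\phi-d\psi)^2,$$ $$A=a_0\,dt+a_\phi(\sin^2\theta\,d\phi+\cos^2\theta\,d\psi).$$ The Einstein--Maxwell equations are $\nabla^\mu F_{\mu\nu}=0$ with $F=dA$, together with $R_{\mu\nu}-\frac12 \mathcal R g_{\mu\nu}=2T_{\mu\nu}$, where $\mathcal R$ is the scalar curvature and $T_{\mu\nu}=F_{\mu\rho}F_\nu{}^\rho-\frac14 g_{\mu\nu}F_{\rho\sigma}F^{\rho\sigma}$. *)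

(* Defs.v *)
From Stdlib Require Import Reals.
From Coquelicot Require Import Coquelicot.
Open Scope R_scope.

Inductive coord : Set := ct | cR | cth | cphi | cpsi.

Definition coord_eq_dec (i j : coord) : {i = j} + {i <> j}.
Proof. decide equality. Defined.

Definition point := coord -> R.

Definition upd (x : point) (i : coord) (s : R) : point :=
  fun j => if coord_eq_dec i j then s else x j.

Definition csum (u : coord -> R) : R := u ct + u cR + u cth + u cphi + u cpsi.

Definition scalar_field := point -> R.
Definition covector_field := point -> coord -> R.
Definition tensor2 := point -> coord -> coord -> R.

Definition partial (i : coord) (u : scalar_field) : scalar_field :=
  fun x => Derive (fun s => u (upd x i s)) (x i).

Definition kronecker (i j : coord) : R := if coord_eq_dec i j then 1 else 0.

Definition inverse_on (U : point -> Prop) (g gi : tensor2) : Prop :=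
  forall x, U x -> forall i j,
    csum (fun k => g x i k * gi x k j) = kronecker i j /\
    csum (fun k => gi x i k * g x k j) = kronecker i j.

(** In the following definitions [g] is a metric g_{ij} and [gi] its inverse
    g^{ij}. [christoffel g gi k i j] is Gamma^k_{ij}. *)
Definition christoffel (g gi : tensor2) (k i j : coord) : scalar_field :=
  fun x => / 2 * csum (fun l => gi x k l *
    (partial i (fun y => g y j l) x + partial j (fun y => g y i l) x
     - partial l (fun y => g y i j) x)).

(** [riemann g gi r s i j] is
    R^r_{sij} = d_i Gamma^r_{js} - d_j Gamma^r_{is}
                + Gamma^r_{il} Gamma^l_{js} - Gamma^r_{jl} Gamma^l_{is}. *)
Definition riemann (g gi : tensor2) (r s i j : coord) : scalar_field :=
  let G := christoffel g gi in
  fun x => partial i (G r j s) x - partial j (G r i s) x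
    + csum (fun l => G r i l x * G l j s x - G r j l x * G l i s x).

Definition ricci (g gi : tensor2) : tensor2 :=
  fun x i j => csum (fun r => riemann g gi r i r j x).

Definition scalar_curvature (g gi : tensor2) : scalar_field :=
  fun x => csum (fun i => csum (fun j => gi x i j * ricci g gi x i j)).

Definition field_strength (A : covector_field) : tensor2 :=
  fun x i j => partial i (fun y => A y j) x - partial j (fun y => A y i) x.

(** [cov_deriv2 g gi F l i j] is nabla_l F_{ij}. *)
Definition cov_deriv2 (g gi F : tensor2) (l i j : coord) : scalar_field :=
  fun x => partial l (fun y => F y i j) x
    - csum (fun s => christoffel g gi s l i x * F x s j)
    - csum (fun s => christoffel g gi s l j x * F x i s).

(** nabla^i F_{ij} *)
Definition divergence2 (g gi F : tensor2) : covector_field :=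
  fun x j => csum (fun i => csum (fun l => gi x i l * cov_deriv2 g gi F l i j x)).

(** F_{ik} F_j^k *)
Definition contract_FF (gi F : tensor2) : tensor2 :=
  fun x i j => csum (fun k => csum (fun l => F x i k * (gi x k l * F x j l))).

(** F_{ij} F^{ij}, the trace of F_{ik} F_j^k. *)
Definition norm2_F (gi F : tensor2) : scalar_field :=
  fun x => csum (fun i => csum (fun j => gi x i j * contract_FF gi F x i j)).

Definition stress_energy (g gi F : tensor2) : tensor2 :=
  fun x i j => contract_FF gi F x i j - / 4 * g x i j * norm2_F gi F x.

(** Since the inverse metric on [U] is unique, the existential merely names it
    (and asserts that [g] is nondegenerate). *)
Definition einstein_maxwell (U : point -> Prop) (g : tensor2) (A : covector_field)
    : Prop :=
  exists gi : tensor2, inverse_on U g gi /\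
    forall x, U x ->
      (forall j, divergence2 g gi (field_strength A) x j = 0) /\
      (forall i j,
         ricci g gi x i j - / 2 * scalar_curvature g gi x * g x i j
         = 2 * stress_energy g gi (field_strength A) x i j).

Definition in_interval (a b : Rbar) (x : R) : Prop :=
  Rbar_lt a (Finite x) /\ Rbar_lt (Finite x) b.

Definition smooth_on (a b : Rbar) (u : R -> R) : Prop :=
  forall (n : nat) (x : R), in_interval a b x -> ex_derive_n u n x.

Definition ansatz_domain (a b : Rbar) (x : point) : Prop :=
  in_interval a b (x cR) /\ 0 < x cth < PI / 2.

(** The components of the square w (x) w of a one-form w. *)
Definition sq (w : coord -> R) (i j : coord) : R := w i * w j.

(** [d c] is the coordinate one-form dx^c. *)
Definition d (c : coord) : coord -> R := kronecker c.

Definition ansatz_metric (f m N varpi : R -> R) : tensor2 :=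
  fun x i j =>
    let r := x cR in
    let S := sin (x cth) in
    let K := cos (x cth) in
    - f r * sq (d ct) i j
    + m r / f r * (sq (d cR) i j / (4 * N r) + sq (d cth) i j)
    + N r / m r *
        (S ^ 2 * sq (fun k => d cphi k - varpi r * d ct k) i j
         + K ^ 2 * sq (fun k => d cpsi k - varpi r * d ct k) i j)
    + (m r ^ 2 - f r * N r) / (m r * f r) * S ^ 2 * K ^ 2
        * sq (fun k => d cphi k - d cpsi k) i j.

Definition ansatz_potential (a0 aphi : R -> R) : covector_field :=
  fun x i =>
    a0 (x cR) * d ct i
    + aphi (x cR) * (sin (x cth) ^ 2 * d cphi i + cos (x cth) ^ 2 * d cpsi i).

Definition conservation_laws (f m N varpi a0 aphi : R -> R) (Q J x : R) : Prop :=
  Derive_n N 2 x = 2 /\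
  N x / f x * (Derive a0 x + varpi x * Derive aphi x) = - Q /\
  N x ^ 2 / (f x * m x) * Derive varpi x + 4 * Q * aphi x = - 2 * J.

Definition second_order_equations (f m N aphi : R -> R) (Q J x : R) : Prop :=
  (f x ^ 2 * m x * Derive (fun y => m y / f y ^ 2 * Derive f y) x
   - m x * Derive m x * (Derive m x / m x - 2 * (Derive N x / N x)) * f x
   - (4 * (m x ^ 2 / N x) - f x) * f x
   = 8 / 3 * (f x * m x / N x)
       * (2 * m x ^ 2 * Derive aphi x ^ 2 - f x * aphi x ^ 2)
     - 4 * Q ^ 2 / 3 * (f x ^ 2 * m x ^ 2 / N x ^ 2)) /\
  (f x * m x * Derive (fun y => N y / m y * Derive m y) x
   + (f x ^ 2 * N x / m x ^ 2 - 2 * f x) * m x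
   = 4 / 3 * f x * (2 * m x ^ 2 * Derive aphi x ^ 2 - f x * aphi x ^ 2)
     + 4 * Q ^ 2 / 3 * (f x ^ 2 * m x / N x)
     + 4 * (f x ^ 2 * m x ^ 2 / N x ^ 2) * (J + 2 * Q * aphi x) ^ 2) /\
  (m x * Derive (fun y => m y * Derive aphi y) x - f x * aphi x
   = 2 * Q * (f x * m x ^ 2 / N x ^ 2) * (J + 2 * Q * aphi x)).

Definition constraint (f m N aphi : R -> R) (Q J x : R) : R :=
  m x ^ 2 * Derive aphi x ^ 2
  - (f x * aphi x ^ 2 - m x + f x * N x / (4 * m x)
     + Q ^ 2 * (f x * m x / N x)
     + f x * m x ^ 2 / N x ^ 2 * (J + 2 * Q * aphi x) ^ 2
     + N x * Derive m x / 8
         * (Derive f x / f x - 2 * (Derive m x / m x) + 4 * (Derive N x / N x))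
     - N x * m x * Derive f x / (8 * f x)
         * (2 * (Derive f x / f x) - Derive m x / m x + 2 * (Derive N x / N x))).

(* Main.v *)
Require Import Defs.
From Stdlib Require Import Reals Lra Classical.
From Coquelicot Require Import Coquelicot.
Open Scope R_scope.

(** The ansatz metric is of cohomogeneity one: with [sigma = sin^2 th dphi + cos^2 th dpsi]
    and [chi = dphi - dpsi] it equals
      - f dt^2 + m/(4fN) dR^2 + (N/m) (sigma - varpi dt)^2
        + (m/f) (dth^2 + sin^2 th cos^2 th chi^2),
    so its Christoffel symbols and its Ricci tensor are combinations of products of the
    coframe (dt, dR, sigma - varpi dt, dth, chi) with coefficients that are functions of R
    apart from a few trigonometric factors.  Trace reversal turns Einstein's equations into
    R_ij = 2 F_ik F_j^k - g_ij F^2 / 3, and comparing coefficients leaves five ordinary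
    differential equations, to which Maxwell's equations add two.  The dt component of
    Maxwell's equations and the mixed (dt, sigma - varpi dt) component of Einstein's are exact
    derivatives, and integrate to the constants [Q] and [J]; the other five are invertible
    linear combinations of [N'' = 2], the three second-order equations and the constraint. *)

(** * Pruning zero terms *)

(* Tensor contractions over the five coordinates produce mostly terms with a factor
   [kronecker i j = 0]. The tactic [prune] removes them by reflection, because [field] would
   still multiply their denominators into the common one. *)
Inductive expr :=
| Zero | One | Atom (x : R) | Add (a b : expr) | Sub (a b : expr) | Opp (a : expr)
| Mul (a b : expr) | Div (a : expr) (x : R).

Fixpoint eval (e : expr) : R :=
  match e with
  | Zero => 0 | One => 1 | Atom x => x
  | Add a b => eval a + eval b | Sub a b => eval a - eval b | Opp a => - eval a
  | Mul a b => eval a * eval b | Div a x => eval a / x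
  end.

Definition prune_add a b :=
  match a, b with Zero, _ => b | _, Zero => a | _, _ => Add a b end.
Definition prune_opp a := match a with Zero => Zero | Opp b => b | _ => Opp a end.
Definition prune_sub a b :=
  match a, b with Zero, _ => prune_opp b | _, Zero => a | _, _ => Sub a b end.
Definition prune_mul a b :=
  match a, b with
  | Zero, _ | _, Zero => Zero | One, _ => b | _, One => a | _, _ => Mul a b
  end.
Definition prune_div a x := match a with Zero => Zero | _ => Div a x end.

Fixpoint prune (e : expr) : expr :=
  match e with
  | Add a b => prune_add (prune a) (prune b) | Sub a b => prune_sub (prune a) (prune b)
  | Opp a => prune_opp (prune a) | Mul a b => prune_mul (prune a) (prune b)
  | Div a x => prune_div (prune a) x | _ => e
  end.

Lemma eval_prune e : eval (prune e) = eval e.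
Proof.
  assert (Hopp : forall a, eval (prune_opp a) = - eval a).
  { intros []; simpl; ring. }
  induction e as [| | |a IHa b IHb|a IHa b IHb|a IHa|a IHa b IHb|a IHa x]; simpl;
    try reflexivity; try rewrite <- IHa; try rewrite <- IHb.
  - destruct (prune a), (prune b); simpl; ring.
  - unfold prune_sub. destruct (prune a), (prune b); rewrite ?Hopp; simpl; ring.
  - apply Hopp.
  - destruct (prune a), (prune b); simpl; ring.
  - destruct (prune a); simpl; unfold Rdiv; ring.
Qed.

Lemma eval_prune_inj a b : eval (prune a) = eval (prune b) -> eval a = eval b.
Proof. now rewrite !eval_prune. Qed.

(** Denominators stay opaque, and the right factor of a product whose left factor is literally zero
    is not traversed, because pruning discards it. *)
Ltac reify t :=
  lazymatch t with
  | 0 => constr:(Zero)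
  | 1 => constr:(One)
  | ?a + ?b => let x := reify a in let y := reify b in constr:(Add x y)
  | ?a - ?b => let x := reify a in let y := reify b in constr:(Sub x y)
  | ?a * ?b =>
    let x := reify a in
    lazymatch x with
    | Zero => constr:(Mul Zero (Atom b))
    | _ => let y := reify b in constr:(Mul x y)
    end
  | ?a / ?b => let x := reify a in constr:(Div x b)
  | - ?a => let x := reify a in constr:(Opp x)
  | _ => constr:(Atom t)
  end.

Ltac prune :=
  lazymatch goal with
  | |- ?l = ?r =>
    let x := reify l in let y := reify r in
    apply (eval_prune_inj x y);
    cbv [eval prune prune_add prune_sub prune_opp prune_mul prune_div]
  end.

(** * Cohomogeneity-one metrics *)

(* The coefficients of the metric
     - gtt dt^2 + gRR dR^2 + gff (sigma - twist dt)^2 + gbb (dth^2 + sin^2 th cos^2 th chi^2);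
   [log_x] is half the logarithmic derivative of [gxx]. *)
Record profile := Profile {
  gtt : R -> R; gRR : R -> R; gff : R -> R; gbb : R -> R; twist : R -> R;
  log_t : R -> R; log_R : R -> R; log_f : R -> R; log_b : R -> R; dtwist : R -> R }.

(** First derivatives of the metric coefficients are expressed through the [log_x] and [dtwist], so
    the second derivatives that enter the curvature are first derivatives of these functions. This
    is why differentiability of the latter is the last requirement. *)
Record regular_profile (p : profile) (r : R) : Prop := RegularProfile {
  gtt_pos : 0 < gtt p r; gRR_pos : 0 < gRR p r; gff_pos : 0 < gff p r; gbb_pos : 0 < gbb p r;
  gtt_der : is_derive (gtt p) r (2 * log_t p r * gtt p r);
  gRR_der : is_derive (gRR p) r (2 * log_R p r * gRR p r);
  gff_der : is_derive (gff p) r (2 * log_f p r * gff p r);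
  gbb_der : is_derive (gbb p) r (2 * log_b p r * gbb p r);
  twist_der : is_derive (twist p) r (dtwist p r);
  log_t_der : ex_derive (log_t p) r;
  log_R_der : ex_derive (log_R p) r;
  log_f_der : ex_derive (log_f p) r;
  log_b_der : ex_derive (log_b p) r;
  dtwist_der : ex_derive (dtwist p) r }.

Definition fiber_form (w th : R) (i : coord) : R :=
  sin th ^ 2 * d cphi i + cos th ^ 2 * d cpsi i - w * d ct i.
Definition base_form (i : coord) : R := d cphi i - d cpsi i.
(* [frame_t], [frame_f], [frame_b] is the frame dual to [d ct], [fiber_form], [base_form]. *)
Definition frame_t (w : R) (k : coord) : R := d ct k + w * (d cphi k + d cpsi k).
Definition frame_f (k : coord) : R := d cphi k + d cpsi k.
Definition frame_b (th : R) (k : coord) : R := cos th ^ 2 * d cphi k - sin th ^ 2 * d cpsi k.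

Definition sym_prod (u v : coord -> R) (i j : coord) : R := u i * v j + v i * u j.
Definition wedge (u v : coord -> R) (i j : coord) : R := u i * v j - v i * u j.

(** With polar angle 2 th this is the round 2-sphere of radius 1/2, the base of the Hopf fibration.
    The connection form sigma has curvature dsigma = 2 sin th cos th dth /\ chi, twice the area
    form. *)
Definition base_metric (th : R) (i j : coord) : R :=
  sq (d cth) i j + sin th ^ 2 * cos th ^ 2 * sq base_form i j.

(** Serves as a rewriting rule for [field]: it lowers every power of cos th to at most the first,
    and trigonometric identities become polynomial ones. *)
Lemma cos_sq th : cos th ^ 2 = 1 - sin th ^ 2.
Proof. generalize (sin2_cos2 th); unfold Rsqr; simpl; lra. Qed.

Ltac components :=
  cbv beta iota zeta delta [csum sq sym_prod wedge base_metric frame_t frame_f frame_b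
    fiber_form base_form d kronecker coord_eq_dec coord_rec coord_rect sumbool_rec sumbool_rect].

Ltac trig_field Hcos :=
  prune; field [Hcos]; repeat split; apply Rgt_not_eq; assumption.

Definition metric p (i j : coord) (r th : R) : R :=
  - gtt p r * sq (d ct) i j + gRR p r * sq (d cR) i j
  + gff p r * sq (fiber_form (twist p r) th) i j + gbb p r * base_metric th i j.

Definition inverse_metric p (i j : coord) (r th : R) : R :=
  - / gtt p r * sq (frame_t (twist p r)) i j + / gRR p r * sq (d cR) i j
  + / gff p r * sq frame_f i j
  + / gbb p r * (sq (d cth) i j + sq (frame_b th) i j / (sin th ^ 2 * cos th ^ 2)).

(* Here and below the suffixes [_R] and [_th] stand for the partial derivatives. *)
Definition metric_R p (i j : coord) (r th : R) : R :=
  - (2 * log_t p r * gtt p r) * sq (d ct) i j + 2 * log_R p r * gRR p r * sq (d cR) i j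
  + 2 * log_f p r * gff p r * sq (fiber_form (twist p r) th) i j
  - gff p r * dtwist p r * sym_prod (d ct) (fiber_form (twist p r) th) i j
  + 2 * log_b p r * gbb p r * base_metric th i j.

Definition metric_th p (i j : coord) (r th : R) : R :=
  2 * sin th * cos th *
   (gbb p r * (cos th ^ 2 - sin th ^ 2) * sq base_form i j
   + gff p r * sym_prod base_form (fiber_form (twist p r) th) i j).

(** [auto_derive] produces eta-expanded functions under [Derive]; [change] identifies them up to
    conversion before the known derivative is substituted. *)
Ltac rewrite_Derive :=
  repeat match goal with
  | H : is_derive ?f ?x ?l |- context [Derive ?g ?x] =>
     change (Derive g x) with (Derive f x); rewrite (is_derive_unique f x l H)
  end.

Lemma metric_is_derive_R p i j r th : regular_profile p r ->
  is_derive (fun r => metric p i j r th) r (metric_R p i j r th).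
Proof.
  intros [? ? ? ? dt dR df db dw _ _ _ _ _].
  unfold metric, metric_R, sym_prod, sq, fiber_form.
  auto_derive.
  - repeat split; eexists; eassumption.
  - rewrite_Derive. ring.
Qed.

Lemma metric_is_derive_th p i j r th :
  is_derive (fun th => metric p i j r th) th (metric_th p i j r th).
Proof.
  unfold metric, metric_th, base_metric, sym_prod, sq, fiber_form, base_form.
  auto_derive; [exact I|ring].
Qed.

(** The upper index is expanded in the frame and the lower ones in symmetric products of the dual
    coframe. The terms in [v] come from the twist, those with gff / gbb from the Hopf curvature. *)
Definition Gamma p (k i j : coord) (r th : R) : R :=
  let v := dtwist p r in
  let eta := fiber_form (twist p r) th in
  let SK := sin th * cos th in
  let c := cos th ^ 2 - sin th ^ 2 in
  d cR k * (log_R p r * sq (d cR) i j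
     - / gRR p r *
       (- (log_t p r * gtt p r) * sq (d ct) i j + log_f p r * gff p r * sq eta i j
        - / 2 * gff p r * v * sym_prod (d ct) eta i j
        + log_b p r * gbb p r * base_metric th i j))
  + d cth k * (log_b p r * sym_prod (d cR) (d cth) i j
     - SK * (c * sq base_form i j + gff p r / gbb p r * sym_prod base_form eta i j))
  + frame_t (twist p r) k * (log_t p r * sym_prod (d cR) (d ct) i j
     + gff p r * v / (2 * gtt p r) * sym_prod (d cR) eta i j)
  + frame_f k * (log_f p r * sym_prod (d cR) eta i j - / 2 * v * sym_prod (d cR) (d ct) i j
     + SK * sym_prod (d cth) base_form i j)
  + frame_b th k * (log_b p r * sym_prod (d cR) base_form i j
     + (gff p r / gbb p r * sym_prod (d cth) eta i j + c * sym_prod (d cth) base_form i j) / SK).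

(** Nothing depends on t, phi, psi, so the partial derivative in direction i is [d cR i] times the
    R-derivative plus [d cth i] times the th-derivative. *)
Lemma Gamma_koszul p k i j r th : regular_profile p r -> 0 < sin th -> 0 < cos th ->
  / 2 * csum (fun l => inverse_metric p k l r th *
    ((d cR i * metric_R p j l r th + d cth i * metric_th p j l r th)
     + (d cR j * metric_R p i l r th + d cth j * metric_th p i l r th)
     - (d cR l * metric_R p i j r th + d cth l * metric_th p i j r th)))
  = Gamma p k i j r th.
Proof.
  intros [? ? ? ? _ _ _ _ _ _ _ _ _ _] ? ?. pose proof (cos_sq th) as Hcos.
  unfold inverse_metric, metric_R, metric_th, Gamma.
  destruct k, i, j; components; trig_field Hcos.
Qed.

(** The frame itself varies with R through the twist: [fiber_form] has derivative - v dt and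
    [frame_t] has derivative v [frame_f]. *)
Definition Gamma_R p (k i j : coord) (r th : R) : R :=
  let log_t' := Derive (log_t p) r in let log_R' := Derive (log_R p) r in
  let log_f' := Derive (log_f p) r in let log_b' := Derive (log_b p) r in
  let v := dtwist p r in let v' := Derive (dtwist p) r in
  let eta := fiber_form (twist p r) th in
  let SK := sin th * cos th in
  let q := gff p r / gbb p r in
  let q_log' := 2 * log_f p r - 2 * log_b p r in
  d cR k * (log_R' * sq (d cR) i j
     - / gRR p r *
       ((- (log_t' + 2 * log_t p r ^ 2) * gtt p r + gff p r * v ^ 2
         + 2 * log_R p r * (log_t p r * gtt p r)) * sq (d ct) i j
        + (log_f' + 2 * log_f p r ^ 2 - 2 * log_R p r * log_f p r) * gff p r * sq eta i j
        - gff p r * (2 * log_f p r * v + / 2 * v' - log_R p r * v) * sym_prod (d ct) eta i j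
        + (log_b' + 2 * log_b p r ^ 2 - 2 * log_R p r * log_b p r) * gbb p r
          * base_metric th i j))
  + d cth k * (log_b' * sym_prod (d cR) (d cth) i j
     - SK * q * (q_log' * sym_prod base_form eta i j - v * sym_prod base_form (d ct) i j))
  + v * frame_f k * (log_t p r * sym_prod (d cR) (d ct) i j
     + gff p r * v / (2 * gtt p r) * sym_prod (d cR) eta i j)
  + frame_t (twist p r) k *
    ((log_t' - gff p r * v ^ 2 / (2 * gtt p r)) * sym_prod (d cR) (d ct) i j
     + gff p r / (2 * gtt p r) * (2 * log_f p r * v - 2 * log_t p r * v + v')
       * sym_prod (d cR) eta i j)
  + frame_f k * (log_f' * sym_prod (d cR) eta i j
     - (log_f p r * v + / 2 * v') * sym_prod (d cR) (d ct) i j)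
  + frame_b th k * (log_b' * sym_prod (d cR) base_form i j
     + q * (q_log' * sym_prod (d cth) eta i j - v * sym_prod (d cth) (d ct) i j) / SK).

(** In th, [fiber_form] has derivative 2 SK [base_form], [frame_b] has derivative - 2 SK [frame_f],
    SK has derivative c, and c has derivative - 4 SK. *)
Definition Gamma_th p (k i j : coord) (r th : R) : R :=
  let v := dtwist p r in
  let eta := fiber_form (twist p r) th in
  let SK := sin th * cos th in
  let c := cos th ^ 2 - sin th ^ 2 in
  let q := gff p r / gbb p r in
  d cR k * (- / gRR p r * (2 * SK) *
     (log_f p r * gff p r * sym_prod base_form eta i j
      - / 2 * gff p r * v * sym_prod (d ct) base_form i j
      + log_b p r * gbb p r * c * sq base_form i j))
  - d cth k * (c * (c * sq base_form i j + q * sym_prod base_form eta i j)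
     + 4 * SK ^ 2 * (q - 1) * sq base_form i j)
  + frame_t (twist p r) k * (gff p r * v / gtt p r * SK * sym_prod (d cR) base_form i j)
  + frame_f k * (2 * SK * log_f p r * sym_prod (d cR) base_form i j
     + c * sym_prod (d cth) base_form i j)
  - 2 * frame_f k * (SK * log_b p r * sym_prod (d cR) base_form i j
     + q * sym_prod (d cth) eta i j + c * sym_prod (d cth) base_form i j)
  + frame_b th k * ((2 * q - 4) * sym_prod (d cth) base_form i j
     - c * (q * sym_prod (d cth) eta i j + c * sym_prod (d cth) base_form i j) / SK ^ 2).

Lemma Gamma_is_derive_R p k i j r th : regular_profile p r -> 0 < sin th -> 0 < cos th ->
  is_derive (fun r => Gamma p k i j r th) r (Gamma_R p k i j r th).
Proof.
  intros [? ? ? ? dt dR df db dw ? ? ? ? ?] HS HK.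
  unfold Gamma, Gamma_R, sym_prod, sq, frame_t, frame_f, fiber_form.
  auto_derive.
  - repeat split; try assumption; try (eexists; eassumption); nra.
  - rewrite_Derive.
    repeat match goal with |- context [Derive (fun x => ?f p x) r] =>
      change (Derive (fun x => f p x) r) with (Derive (f p) r) end.
    field. repeat split; nra.
Qed.

Lemma Gamma_is_derive_th p k i j r th : regular_profile p r -> 0 < sin th -> 0 < cos th ->
  is_derive (fun th => Gamma p k i j r th) th (Gamma_th p k i j r th).
Proof.
  intros [? ? ? ? _ _ _ _ _ _ _ _ _ _] HS HK.
  unfold Gamma, Gamma_th, base_metric, sym_prod, sq, fiber_form, frame_b, base_form, frame_f.
  auto_derive.
  - repeat split; nra.
  - field. repeat split; nra.
Qed.

(* The logarithmic derivative of sqrt|g| / gRR. *)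
Definition log_density p r : R := log_t p r + log_f p r + 2 * log_b p r - log_R p r.
Definition twist_energy p r : R := gff p r * dtwist p r ^ 2 / (2 * gtt p r).

(** A Kaluza-Klein decomposition. The 4 is the Ricci curvature of the sphere of radius 1/2; the Hopf
    curvature adds 2 gff^2 / gbb^2 along the fibre and subtracts 2 gff / gbb on the base. The factor
    [mu] comes from the divergence of a radial gradient. *)
Definition Ricci p (i j : coord) (r th : R) : R :=
  let log_t' := Derive (log_t p) r in
  let log_f' := Derive (log_f p) r in let log_b' := Derive (log_b p) r in
  let v := dtwist p r in let v' := Derive (dtwist p) r in
  let eta := fiber_form (twist p r) th in
  let mu := log_density p r in
  gtt p r / gRR p r * (log_t' - twist_energy p r + mu * log_t p r) * sq (d ct) i j
  + gff p r / (2 * gRR p r) * (v' + (mu + 2 * log_f p r - 2 * log_t p r) * v)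
    * sym_prod (d ct) eta i j
  + (2 * gff p r ^ 2 / gbb p r ^ 2
     - gff p r / gRR p r * (log_f' + twist_energy p r + mu * log_f p r)) * sq eta i j
  + (4 - 2 * gff p r / gbb p r - gbb p r / gRR p r * (log_b' + mu * log_b p r))
    * base_metric th i j
  - (log_t' + log_f' + 2 * log_b' + log_t p r ^ 2 + log_f p r ^ 2 + 2 * log_b p r ^ 2
     - twist_energy p r - log_R p r * (log_t p r + log_f p r + 2 * log_b p r)) * sq (d cR) i j.

Lemma Ricci_contraction p i j r th : regular_profile p r -> 0 < sin th -> 0 < cos th ->
  csum (fun s =>
    (d cR s * Gamma_R p s j i r th + d cth s * Gamma_th p s j i r th)
    - (d cR j * Gamma_R p s s i r th + d cth j * Gamma_th p s s i r th)
    + csum (fun l => Gamma p s s l r th * Gamma p l j i r th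
                     - Gamma p s j l r th * Gamma p l s i r th))
  = Ricci p i j r th.
Proof.
  intros [? ? ? ? _ _ _ _ _ _ _ _ _ _] ? ?. pose proof (cos_sq th) as Hcos.
  unfold Ricci, twist_energy, log_density, Gamma, Gamma_R, Gamma_th.
  destruct i, j; components; trig_field Hcos.
Qed.

(** * The Maxwell field *)

(* [dA = electric dR /\ dt + dpot_f dR /\ (sigma - twist dt) + pot_f dsigma], hence
   [electric = pot_t' + twist * pot_f']. *)
Record potential := Potential {
  pot_t : R -> R; pot_f : R -> R; electric : R -> R; dpot_f : R -> R }.

Record regular_potential (p : profile) (A : potential) (r : R) : Prop := RegularPotential {
  pot_t_der : is_derive (pot_t A) r (electric A r - twist p r * dpot_f A r);
  pot_f_der : is_derive (pot_f A) r (dpot_f A r);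
  electric_der : ex_derive (electric A) r;
  dpot_f_der : ex_derive (dpot_f A) r }.

Definition potential_form A (i : coord) (r th : R) : R :=
  pot_t A r * d ct i + pot_f A r * (sin th ^ 2 * d cphi i + cos th ^ 2 * d cpsi i).

Definition potential_form_R p A (i : coord) (r th : R) : R :=
  electric A r * d ct i + dpot_f A r * fiber_form (twist p r) th i.

Definition potential_form_th A (i : coord) (r th : R) : R :=
  2 * (sin th * cos th) * pot_f A r * base_form i.

Definition faraday p A (i j : coord) (r th : R) : R :=
  electric A r * wedge (d cR) (d ct) i j
  + dpot_f A r * wedge (d cR) (fiber_form (twist p r) th) i j
  + 2 * (sin th * cos th) * pot_f A r * wedge (d cth) base_form i j.

Definition faraday_R p A (i j : coord) (r th : R) : R :=
  (Derive (electric A) r - dpot_f A r * dtwist p r) * wedge (d cR) (d ct) i j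
  + Derive (dpot_f A) r * wedge (d cR) (fiber_form (twist p r) th) i j
  + 2 * (sin th * cos th) * dpot_f A r * wedge (d cth) base_form i j.

Definition faraday_th A (i j : coord) (r th : R) : R :=
  2 * (sin th * cos th) * dpot_f A r * wedge (d cR) base_form i j
  + 2 * (cos th ^ 2 - sin th ^ 2) * pot_f A r * wedge (d cth) base_form i j.

Definition faraday_sq p A (i j : coord) (r th : R) : R :=
  (dpot_f A r ^ 2 / gff p r - electric A r ^ 2 / gtt p r) * sq (d cR) i j
  + / gRR p r * sq (fun k => electric A r * d ct k + dpot_f A r * fiber_form (twist p r) th k) i j
  + 4 * pot_f A r ^ 2 / gbb p r * base_metric th i j.

Definition faraday_norm2 p A r : R :=
  2 / gRR p r * (dpot_f A r ^ 2 / gff p r - electric A r ^ 2 / gtt p r)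
  + 8 * pot_f A r ^ 2 / gbb p r ^ 2.

Definition faraday_div p A j r th : R :=
  let mu := log_density p r in
  / gRR p r * (Derive (electric A) r + (mu - 2 * log_t p r) * electric A r) * d ct j
  + (/ gRR p r * (Derive (dpot_f A) r + (mu - 2 * log_f p r) * dpot_f A r
                  - gff p r * electric A r * dtwist p r / gtt p r)
     - 4 * pot_f A r * gff p r / gbb p r ^ 2) * fiber_form (twist p r) th j.

Lemma potential_form_is_derive_R p A i r th : regular_potential p A r ->
  is_derive (fun r => potential_form A i r th) r (potential_form_R p A i r th).
Proof.
  intros [d0 dq _ _]. unfold potential_form, potential_form_R, fiber_form. auto_derive.
  - repeat split; eexists; eassumption.
  - rewrite_Derive. ring.
Qed.

Lemma potential_form_is_derive_th A i r th :
  is_derive (fun th => potential_form A i r th) th (potential_form_th A i r th).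
Proof. unfold potential_form, potential_form_th, base_form. auto_derive; [exact I|ring]. Qed.

Lemma faraday_is_derive_R p A i j r th : regular_profile p r -> regular_potential p A r ->
  is_derive (fun r => faraday p A i j r th) r (faraday_R p A i j r th).
Proof.
  intros [_ _ _ _ _ _ _ _ dw _ _ _ _ _] [_ dq ? ?].
  unfold faraday, faraday_R, wedge, fiber_form. auto_derive.
  - repeat split; try assumption; eexists; eassumption.
  - rewrite_Derive.
    repeat match goal with |- context [Derive (fun x => ?f A x) r] =>
      change (Derive (fun x => f A x) r) with (Derive (f A) r) end.
    ring.
Qed.

Lemma faraday_is_derive_th p A i j r th :
  is_derive (fun th => faraday p A i j r th) th (faraday_th A i j r th).
Proof. unfold faraday, faraday_th, wedge, base_form, fiber_form. auto_derive; [exact I|ring]. Qed.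

Lemma faraday_of_potential p A i j r th :
  (d cR i * potential_form_R p A j r th + d cth i * potential_form_th A j r th)
  - (d cR j * potential_form_R p A i r th + d cth j * potential_form_th A i r th)
  = faraday p A i j r th.
Proof. unfold potential_form_R, potential_form_th, faraday, wedge. ring. Qed.

Lemma faraday_sq_contraction p A i j r th : regular_profile p r -> 0 < sin th -> 0 < cos th ->
  csum (fun k => csum (fun l =>
    faraday p A i k r th * (inverse_metric p k l r th * faraday p A j l r th)))
  = faraday_sq p A i j r th.
Proof.
  intros [? ? ? ? _ _ _ _ _ _ _ _ _ _] ? ?. pose proof (cos_sq th) as Hcos.
  unfold faraday, inverse_metric, faraday_sq.
  destruct i, j; components; trig_field Hcos.
Qed.

Lemma faraday_norm2_contraction p A r th : regular_profile p r -> 0 < sin th -> 0 < cos th ->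
  csum (fun k => csum (fun l => inverse_metric p k l r th * faraday_sq p A k l r th))
  = faraday_norm2 p A r.
Proof.
  intros [? ? ? ? _ _ _ _ _ _ _ _ _ _] ? ?. pose proof (cos_sq th) as Hcos.
  unfold inverse_metric, faraday_sq, faraday_norm2.
  components; trig_field Hcos.
Qed.

Lemma inverse_metric_right p i j r th : regular_profile p r -> 0 < sin th -> 0 < cos th ->
  csum (fun k => metric p i k r th * inverse_metric p k j r th) = kronecker i j.
Proof.
  intros [? ? ? ? _ _ _ _ _ _ _ _ _ _] ? ?. pose proof (cos_sq th) as Hcos.
  unfold inverse_metric, metric.
  destruct i, j; components; trig_field Hcos.
Qed.

Lemma sq_sym u i j : sq u i j = sq u j i.
Proof. apply Rmult_comm. Qed.

Lemma inverse_metric_sym p i j r th : inverse_metric p i j r th = inverse_metric p j i r th.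
Proof. unfold inverse_metric. now rewrite !(sq_sym _ i j). Qed.

Lemma metric_sym p i j r th : metric p i j r th = metric p j i r th.
Proof. unfold metric, base_metric. now rewrite !(sq_sym _ i j). Qed.

Lemma faraday_div_contraction p A j r th : regular_profile p r -> 0 < sin th -> 0 < cos th ->
  csum (fun i => csum (fun l => inverse_metric p i l r th *
    ((d cR l * faraday_R p A i j r th + d cth l * faraday_th A i j r th)
     - csum (fun s => Gamma p s l i r th * faraday p A s j r th)
     - csum (fun s => Gamma p s l j r th * faraday p A i s r th))))
  = faraday_div p A j r th.
Proof.
  intros [? ? ? ? _ _ _ _ _ _ _ _ _ _] ? ?. pose proof (cos_sq th) as Hcos.
  unfold inverse_metric, faraday, faraday_R, faraday_th, Gamma, faraday_div, log_density.
  destruct j; components; trig_field Hcos.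
Qed.

(** * Tensor calculus on the domain of the ansatz *)

Lemma in_interval_locally a b r : in_interval a b r -> locally r (in_interval a b).
Proof.
  apply (locally_open (fun s : R => Rbar_lt a s /\ Rbar_lt s b)); [|easy].
  apply open_and; [apply open_Rbar_gt|apply open_Rbar_lt].
Qed.

Lemma ansatz_domain_locally a b x i : ansatz_domain a b x ->
  locally (x i) (fun s => ansatz_domain a b (upd x i s)).
Proof.
  intros [HR Hth]. unfold ansatz_domain, upd.
  destruct i; cbn; try (apply filter_forall; now intros).
  - eapply filter_imp; [|apply in_interval_locally, HR]. now intros.
  - eapply filter_imp; [|apply (in_interval_locally 0 (PI / 2)), Hth]. now intros.
Qed.

(** The closed form of a field is known only on the domain. Since the domain is open along every
    coordinate line, [Derive] cannot distinguish the two, so closed forms can be differentiated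
    again at each level of the tensor calculus. *)
Lemma partial_eq a b (u : scalar_field) (Phi : R -> R -> R) (DR Dth : R) x i :
  (forall y, ansatz_domain a b y -> u y = Phi (y cR) (y cth)) -> ansatz_domain a b x ->
  is_derive (fun r : R => Phi r (x cth)) (x cR) DR ->
  is_derive (fun th : R => Phi (x cR) th) (x cth) Dth ->
  partial i u x = d cR i * DR + d cth i * Dth.
Proof.
  intros Hu Hx HR Hth. unfold partial.
  rewrite (Derive_ext_loc _ (fun s => Phi (upd x i s cR) (upd x i s cth))).
  2: { eapply filter_imp; [|apply ansatz_domain_locally, Hx]. intros s. apply Hu. }
  apply is_derive_unique in HR, Hth.
  unfold d, kronecker; destruct i; cbn;
    rewrite ?Derive_const, <- HR, <- Hth; ring.
Qed.

Lemma csum_ext u v : (forall i, u i = v i) -> csum u = csum v.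
Proof. intros H. unfold csum. now rewrite !H. Qed.

Lemma csum_exchange (u : coord -> coord -> R) :
  csum (fun i => csum (u i)) = csum (fun j => csum (fun i => u i j)).
Proof. unfold csum. ring. Qed.

Lemma csum_scal c u : csum (fun i => c * u i) = c * csum u.
Proof. unfold csum. ring. Qed.

Lemma csum_kronecker i u : csum (fun k => kronecker i k * u k) = u i.
Proof. destruct i; components; ring. Qed.

Record geometry (a b : Rbar) (p : profile) (g gi : tensor2) : Prop := Geometry {
  profile_regular : forall r, in_interval a b r -> regular_profile p r;
  metric_eq : forall x i j, ansatz_domain a b x -> g x i j = metric p i j (x cR) (x cth);
  inverse_eq : forall x i j, ansatz_domain a b x ->
    gi x i j = inverse_metric p i j (x cR) (x cth) }.

Lemma ansatz_domain_trig a b x : ansatz_domain a b x -> 0 < sin (x cth) /\ 0 < cos (x cth).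
Proof.
  intros [_ [H1 H2]]. split; [apply sin_gt_0; lra | apply cos_gt_0; lra].
Qed.

(** The inverse provided by [einstein_maxwell] is arbitrary. Multiplying [inverse_metric] on the
    left by the identity, written as gi g, and reassociating identifies it with gi. *)
Lemma inverse_unique a b p g gi :
  (forall r, in_interval a b r -> regular_profile p r) ->
  (forall x i j, ansatz_domain a b x -> g x i j = metric p i j (x cR) (x cth)) ->
  inverse_on (ansatz_domain a b) g gi -> geometry a b p g gi.
Proof.
  intros Hp Hg Hgi. split; [assumption..|].
  intros x i j Hx. destruct (ansatz_domain_trig _ _ _ Hx) as [HS HK].
  pose proof (Hp _ (proj1 Hx)) as reg.
  rewrite <- (csum_kronecker i (fun k => inverse_metric p k j (x cR) (x cth))).
  rewrite (csum_ext _ (fun k => csum (fun l =>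
    gi x i l * g x l k * inverse_metric p k j (x cR) (x cth)))).
  2: { intros k. destruct (Hgi x Hx i k) as [_ <-]. unfold csum. ring. }
  rewrite csum_exchange.
  rewrite (csum_ext _ (fun l => gi x i l * kronecker l j)).
  2: { intros l. rewrite <- (inverse_metric_right p l j (x cR) (x cth)) by assumption.
       rewrite <- csum_scal. apply csum_ext. intros k. rewrite Hg by assumption. ring. }
  destruct j; components; ring.
Qed.

(** Only the right inverse was computed by components; the left one follows by transposition, both
    matrices being symmetric. *)
Lemma geometry_inverse a b p g gi : geometry a b p g gi -> inverse_on (ansatz_domain a b) g gi.
Proof.
  intros [Hp Hg Hgi] x Hx i j. destruct (ansatz_domain_trig _ _ _ Hx) as [HS HK].
  pose proof (Hp _ (proj1 Hx)) as reg.
  split; rewrite <- (inverse_metric_right p i j (x cR) (x cth)) by assumption.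
  - apply csum_ext; intros k. now rewrite Hg, Hgi.
  - replace (csum (fun k => metric p i k (x cR) (x cth) * inverse_metric p k j (x cR) (x cth)))
      with (csum (fun k => metric p j k (x cR) (x cth) * inverse_metric p k i (x cR) (x cth))).
    + apply csum_ext; intros k. rewrite Hg, Hgi by assumption.
      rewrite inverse_metric_sym, metric_sym. ring.
    + rewrite !inverse_metric_right by assumption. now destruct i, j.
Qed.

Section Curvature.
Variables (a b : Rbar) (p : profile) (g gi : tensor2).
Hypothesis geo : geometry a b p g gi.

Ltac at_point x Hx :=
  destruct (ansatz_domain_trig _ _ _ Hx) as [?HS ?HK];
  pose proof (profile_regular _ _ _ _ _ geo _ (proj1 Hx)) as ?reg.

Lemma partial_metric x l i j : ansatz_domain a b x ->
  partial l (fun y => g y i j) x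
  = d cR l * metric_R p i j (x cR) (x cth) + d cth l * metric_th p i j (x cR) (x cth).
Proof.
  intros Hx. at_point x Hx.
  apply (partial_eq a b _ (metric p i j)); trivial.
  - intros y. apply (metric_eq _ _ _ _ _ geo).
  - now apply metric_is_derive_R.
  - apply metric_is_derive_th.
Qed.

Lemma christoffel_eq x k i j : ansatz_domain a b x ->
  christoffel g gi k i j x = Gamma p k i j (x cR) (x cth).
Proof.
  intros Hx. at_point x Hx. unfold christoffel.
  rewrite <- Gamma_koszul by assumption. f_equal. apply csum_ext; intros l.
  now rewrite (inverse_eq _ _ _ _ _ geo), !partial_metric by assumption.
Qed.

Lemma partial_christoffel x l k i j : ansatz_domain a b x ->
  partial l (christoffel g gi k i j) x
  = d cR l * Gamma_R p k i j (x cR) (x cth) + d cth l * Gamma_th p k i j (x cR) (x cth).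
Proof.
  intros Hx. at_point x Hx.
  apply (partial_eq a b _ (Gamma p k i j)); trivial.
  - intros y. apply christoffel_eq.
  - now apply Gamma_is_derive_R.
  - now apply Gamma_is_derive_th.
Qed.

Lemma ricci_eq x i j : ansatz_domain a b x ->
  ricci g gi x i j = Ricci p i j (x cR) (x cth).
Proof.
  intros Hx. at_point x Hx. unfold ricci.
  rewrite <- Ricci_contraction by assumption. apply csum_ext; intros k. unfold riemann.
  rewrite !partial_christoffel by assumption. f_equal.
  apply csum_ext; intros l. now rewrite !christoffel_eq.
Qed.

Variables (P : potential) (A : covector_field).
Hypothesis P_regular : forall r, in_interval a b r -> regular_potential p P r.
Hypothesis A_eq : forall x i, ansatz_domain a b x -> A x i = potential_form P i (x cR) (x cth).

Lemma field_strength_eq x i j : ansatz_domain a b x ->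
  field_strength A x i j = faraday p P i j (x cR) (x cth).
Proof.
  intros Hx. unfold field_strength. rewrite <- faraday_of_potential.
  assert (HA : forall k l, partial k (fun y => A y l) x
    = d cR k * potential_form_R p P l (x cR) (x cth)
      + d cth k * potential_form_th P l (x cR) (x cth)).
  { intros k l. apply (partial_eq a b _ (potential_form P l)); trivial.
    - intros y. apply A_eq.
    - apply potential_form_is_derive_R, P_regular, Hx.
    - apply potential_form_is_derive_th. }
  now rewrite !HA.
Qed.

Lemma partial_field_strength x l i j : ansatz_domain a b x ->
  partial l (fun y => field_strength A y i j) x
  = d cR l * faraday_R p P i j (x cR) (x cth) + d cth l * faraday_th P i j (x cR) (x cth).
Proof.
  intros Hx. at_point x Hx.
  apply (partial_eq a b _ (faraday p P i j)); trivial.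
  - intros y. apply field_strength_eq.
  - apply faraday_is_derive_R; [assumption|apply P_regular, Hx].
  - apply faraday_is_derive_th.
Qed.

Lemma contract_FF_eq x i j : ansatz_domain a b x ->
  contract_FF gi (field_strength A) x i j = faraday_sq p P i j (x cR) (x cth).
Proof.
  intros Hx. at_point x Hx. unfold contract_FF. rewrite <- faraday_sq_contraction by assumption.
  apply csum_ext; intros k; apply csum_ext; intros l.
  now rewrite !field_strength_eq, (inverse_eq _ _ _ _ _ geo).
Qed.

Lemma norm2_F_eq x : ansatz_domain a b x ->
  norm2_F gi (field_strength A) x = faraday_norm2 p P (x cR).
Proof.
  intros Hx. at_point x Hx. unfold norm2_F.
  rewrite <- (faraday_norm2_contraction _ _ _ (x cth)) by assumption.
  apply csum_ext; intros k; apply csum_ext; intros l.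
  now rewrite contract_FF_eq, (inverse_eq _ _ _ _ _ geo).
Qed.

Lemma divergence2_eq x j : ansatz_domain a b x ->
  divergence2 g gi (field_strength A) x j = faraday_div p P j (x cR) (x cth).
Proof.
  intros Hx. at_point x Hx. unfold divergence2. rewrite <- faraday_div_contraction by assumption.
  apply csum_ext; intros k; apply csum_ext; intros l. unfold cov_deriv2.
  rewrite partial_field_strength, (inverse_eq _ _ _ _ _ geo) by assumption.
  f_equal. f_equal; [f_equal|]; apply csum_ext; intros s;
    now rewrite christoffel_eq, field_strength_eq.
Qed.

(* In dimension five the trace of the Einstein equations is [Rs = n / 3]. *)
Lemma einstein_trace_reversed x : ansatz_domain a b x ->
  (forall i j, ricci g gi x i j - / 2 * scalar_curvature g gi x * g x i j
               = 2 * stress_energy g gi (field_strength A) x i j)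
  <-> (forall i j, Ricci p i j (x cR) (x cth)
        = 2 * faraday_sq p P i j (x cR) (x cth)
          - / 3 * faraday_norm2 p P (x cR) * metric p i j (x cR) (x cth)).
Proof.
  intros Hx.
  assert (Htr : forall c1 c2 (T : coord -> coord -> R),
    csum (fun i => csum (fun j => gi x i j * (c1 * T i j + c2 * g x i j)))
    = c1 * csum (fun i => csum (fun j => gi x i j * T i j)) + 5 * c2).
  { intros c1 c2 T.
    transitivity (c1 * csum (fun i => csum (fun j => gi x i j * T i j))
      + c2 * csum (fun i => csum (fun j => gi x i j * g x i j))).
    { unfold csum. ring. }
    f_equal. rewrite (csum_ext _ (fun _ => 1)).
    - unfold csum. ring.
    - intros i. transitivity (csum (fun j => gi x i j * g x j i)).
      + apply csum_ext; intros j. now rewrite !(metric_eq _ _ _ _ _ geo), metric_sym.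
      + rewrite (proj2 (geometry_inverse _ _ _ _ _ geo x Hx i i)). now destruct i. }
  pose (n := faraday_norm2 p P (x cR)). pose (Rs := scalar_curvature g gi x).
  assert (HT : forall i j, 2 * stress_energy g gi (field_strength A) x i j
     = 2 * contract_FF gi (field_strength A) x i j + (- / 2 * n) * g x i j).
  { intros i j. unfold stress_energy, n. rewrite norm2_F_eq by assumption. lra. }
  assert (Hn : csum (fun i => csum (fun j =>
    gi x i j * contract_FF gi (field_strength A) x i j)) = n).
  { now apply norm2_F_eq. }
  assert (Heq : (forall i j, Ricci p i j (x cR) (x cth)
        = 2 * faraday_sq p P i j (x cR) (x cth)
          - / 3 * faraday_norm2 p P (x cR) * metric p i j (x cR) (x cth))
     <-> (forall i j, ricci g gi x i j
        = 2 * contract_FF gi (field_strength A) x i j + (- / 3 * n) * g x i j)).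
  { split; intros E i j; specialize (E i j); unfold n in *;
      rewrite ricci_eq, contract_FF_eq, (metric_eq _ _ _ _ _ geo) in * by assumption; lra. }
  rewrite Heq. clear Heq.
  assert (Hcongr : forall T1 T2 : coord -> coord -> R, (forall i j, T1 i j = T2 i j) ->
    csum (fun i => csum (fun j => gi x i j * T1 i j))
    = csum (fun i => csum (fun j => gi x i j * T2 i j))).
  { intros T1 T2 E. apply csum_ext; intros i. apply csum_ext; intros j. now rewrite E. }
  split; intros E.
  (* The metric has trace 5, so tracing gives Rs - 5 Rs / 2 = 2 n - 5 n / 2, that is Rs = n / 3. *)
  - assert (E' : csum (fun i => csum (fun j => gi x i j *
        (1 * ricci g gi x i j + (- / 2 * Rs) * g x i j)))
      = csum (fun i => csum (fun j => gi x i j *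
        (2 * contract_FF gi (field_strength A) x i j + (- / 2 * n) * g x i j)))).
    { apply Hcongr. intros i j. rewrite <- HT, <- E. unfold Rs. ring. }
    rewrite !Htr, Hn in E'. fold (scalar_curvature g gi x) in E'. fold Rs in E'.
    intros i j. specialize (E i j). rewrite HT in E. fold Rs in E.
    replace Rs with (n / 3) in E by lra. lra.
  (* The trace-reversed equations have trace 2 n - 5 n / 3. *)
  - assert (E' : Rs = n / 3).
    { unfold Rs, scalar_curvature. rewrite (Hcongr _ _ E), Htr, Hn. lra. }
    intros i j. rewrite HT, E. fold Rs. rewrite E'. lra.
Qed.

End Curvature.

(** * Reduction to ordinary differential equations *)

(* The coefficients of [R_ij - 2 F_ik F_j^k + g_ij F^2 / 3] and of the divergence of [F], up to
   nonvanishing factors; see [Ricci_residual] and [faraday_div_residual]. *)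
Definition residual_tt p P r : R :=
  Derive (log_t p) r - twist_energy p r + log_density p r * log_t p r
  - 2 * electric P r ^ 2 / gtt p r - / 3 * gRR p r * faraday_norm2 p P r.
Definition residual_tf p P r : R :=
  Derive (dtwist p) r + (log_density p r + 2 * log_f p r - 2 * log_t p r) * dtwist p r
  - 4 * electric P r * dpot_f P r / gff p r.
Definition residual_ff p P r : R :=
  Derive (log_f p) r + twist_energy p r + log_density p r * log_f p r
  - 2 * gRR p r * gff p r / gbb p r ^ 2 + 2 * dpot_f P r ^ 2 / gff p r
  - / 3 * gRR p r * faraday_norm2 p P r.
Definition residual_bb p P r : R :=
  Derive (log_b p) r + log_density p r * log_b p r
  - 4 * gRR p r / gbb p r + 2 * gRR p r * gff p r / gbb p r ^ 2
  + 8 * gRR p r * pot_f P r ^ 2 / gbb p r ^ 2 - / 3 * gRR p r * faraday_norm2 p P r.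
Definition residual_RR p P r : R :=
  - (Derive (log_t p) r + Derive (log_f p) r + 2 * Derive (log_b p) r
     + log_t p r ^ 2 + log_f p r ^ 2 + 2 * log_b p r ^ 2 - twist_energy p r
     - log_R p r * (log_t p r + log_f p r + 2 * log_b p r))
  - 2 * (dpot_f P r ^ 2 / gff p r - electric P r ^ 2 / gtt p r)
  + / 3 * gRR p r * faraday_norm2 p P r.
Definition residual_maxwell_t p P r : R :=
  Derive (electric P) r + (log_density p r - 2 * log_t p r) * electric P r.
Definition residual_maxwell_f p P r : R :=
  Derive (dpot_f P) r + (log_density p r - 2 * log_f p r) * dpot_f P r
  - gff p r * electric P r * dtwist p r / gtt p r
  - 4 * gRR p r * pot_f P r * gff p r / gbb p r ^ 2.

Definition reduced p P r : Prop :=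
  residual_tt p P r = 0 /\ residual_tf p P r = 0 /\ residual_ff p P r = 0 /\
  residual_bb p P r = 0 /\ residual_RR p P r = 0 /\
  residual_maxwell_t p P r = 0 /\ residual_maxwell_f p P r = 0.

Definition invariant_form (c1 c2 c3 c4 c5 w th : R) (i j : coord) : R :=
  c1 * sq (d ct) i j + c2 * sym_prod (d ct) (fiber_form w th) i j + c3 * sq (fiber_form w th) i j
  + c4 * base_metric th i j + c5 * sq (d cR) i j.

(** The system is triangular: the RR and th-th components isolate [c5] and [c4], after which the
    phi-phi, t-phi and t-t components determine [c3], [c2] and [c1] in turn. *)
Lemma invariant_form_eq0 c1 c2 c3 c4 c5 w th : 0 < sin th ->
  (forall i j, invariant_form c1 c2 c3 c4 c5 w th i j = 0) ->
  c1 = 0 /\ c2 = 0 /\ c3 = 0 /\ c4 = 0 /\ c5 = 0.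
Proof.
  intros HS H.
  pose proof (H cR cR) as H5. pose proof (H cth cth) as H4. pose proof (H cphi cphi) as H3.
  pose proof (H ct cphi) as H2. pose proof (H ct ct) as H1. clear H.
  revert H1 H2 H3 H4 H5. unfold invariant_form. components. intros.
  assert (c5 = 0) by lra. assert (c4 = 0) by lra. subst c4 c5.
  assert (Hs : 0 < sin th ^ 2) by nra.
  assert (c3 = 0).
  { apply (Rmult_eq_reg_r (sin th ^ 2 * sin th ^ 2)); nra. }
  subst c3. assert (c2 = 0) by (apply (Rmult_eq_reg_r (sin th ^ 2)); lra).
  subst c2. repeat split; lra.
Qed.

Lemma Ricci_residual p P i j r th : regular_profile p r ->
  Ricci p i j r th
  - (2 * faraday_sq p P i j r th - / 3 * faraday_norm2 p P r * metric p i j r th)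
  = invariant_form (gtt p r / gRR p r * residual_tt p P r)
      (gff p r / (2 * gRR p r) * residual_tf p P r)
      (- (gff p r / gRR p r * residual_ff p P r))
      (- (gbb p r / gRR p r * residual_bb p P r))
      (residual_RR p P r) (twist p r) th i j.
Proof.
  intros [? ? ? ? _ _ _ _ _ _ _ _ _ _].
  unfold invariant_form, Ricci, faraday_sq, metric, residual_tt, residual_tf, residual_ff,
    residual_bb, residual_RR, log_density, twist_energy, sym_prod, sq.
  (* The norm enters both sides linearly and can stay opaque. *)
  generalize (faraday_norm2 p P r). intros n.
  field. repeat split; apply Rgt_not_eq; assumption.
Qed.

Lemma faraday_div_residual p P j r th : regular_profile p r ->
  faraday_div p P j r th
  = / gRR p r *
    (residual_maxwell_t p P r * d ct j + residual_maxwell_f p P r * fiber_form (twist p r) th j).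
Proof.
  intros [? ? ? ? _ _ _ _ _ _ _ _ _ _].
  unfold faraday_div, residual_maxwell_t, residual_maxwell_f, log_density.
  field. repeat split; apply Rgt_not_eq; assumption.
Qed.

Lemma einstein_maxwell_reduced a b p P g A :
  (forall r, in_interval a b r -> regular_profile p r) ->
  (forall r, in_interval a b r -> regular_potential p P r) ->
  (forall x i j, ansatz_domain a b x -> g x i j = metric p i j (x cR) (x cth)) ->
  (forall x i, ansatz_domain a b x -> A x i = potential_form P i (x cR) (x cth)) ->
  einstein_maxwell (ansatz_domain a b) g A <-> (forall r, in_interval a b r -> reduced p P r).
Proof.
  intros Hp HP Hg HA. split.
  - intros [gi [Hgi E]] r Hr.
    (* The residuals depend on R alone, so one point over each r suffices; any angle strictly
       between 0 and pi / 2 would do. *)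
    set (x := fun i => match i with cR => r | cth => PI / 4 | _ => 0 end).
    assert (Hx : ansatz_domain a b x).
    { split; [exact Hr|]. cbn. pose proof PI_RGT_0. lra. }
    pose proof (inverse_unique _ _ _ _ _ Hp Hg Hgi) as geo.
    destruct (E x Hx) as [EM EE].
    pose proof (proj1 (einstein_trace_reversed _ _ _ _ _ geo _ _ HP HA x Hx) EE) as ER.
    destruct (ansatz_domain_trig _ _ _ Hx) as [HS _].
    pose proof (Hp r Hr) as reg.
    pose proof (gtt_pos _ _ reg). pose proof (gRR_pos _ _ reg).
    pose proof (gff_pos _ _ reg). pose proof (gbb_pos _ _ reg).
    assert (EQ := fun i j =>
      eq_trans (eq_sym (Ricci_residual p P i j r (x cth) reg)) (Rminus_diag_eq _ _ (ER i j))).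
    apply invariant_form_eq0 in EQ as [E1 [E2 [E3 [E4 E5]]]]; [|assumption].
    (* The one-form dt has no phi component, so the phi equation isolates the coefficient of
       [fiber_form]; the t equation then gives the other one. *)
    assert (M0 := EM ct). assert (M1 := EM cphi).
    rewrite (divergence2_eq _ _ _ _ _ geo _ _ HP HA) in M0, M1 by assumption.
    rewrite faraday_div_residual in M0, M1 by assumption.
    change (x cR) with r in M0, M1. revert M0 M1. components. intros M0 M1.
    assert (Hi := Rinv_neq_0_compat _ (Rgt_not_eq _ _ (gRR_pos _ _ reg))).
    assert (Hs : sin (x cth) ^ 2 <> 0) by (apply Rgt_not_eq; nra).
    assert (Z1 : residual_maxwell_f p P r = 0).
    { apply (Rmult_eq_reg_l (/ gRR p r * sin (x cth) ^ 2)); [lra|].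
      now apply Rmult_integral_contrapositive_currified. }
    assert (Z0 : residual_maxwell_t p P r = 0).
    { rewrite Z1 in M0. apply (Rmult_eq_reg_l (/ gRR p r)); trivial; lra. }
    assert (Hq : forall u v c, 0 < u -> 0 < v -> u / v * c = 0 -> c = 0).
    { intros u v c Hu Hv Hc. apply (Rmult_eq_reg_l (u / v)); [lra|].
      apply Rgt_not_eq, Rdiv_lt_0_compat; assumption. }
    repeat split; trivial.
    + now apply (Hq (gtt p r) (gRR p r)).
    + apply (Hq (gff p r) (2 * gRR p r)); trivial; lra.
    + apply (Hq (gff p r) (gRR p r)); trivial; lra.
    + apply (Hq (gbb p r) (gRR p r)); trivial; lra.
  - intros H. set (gi := fun x i j => inverse_metric p i j (x cR) (x cth)).
    assert (geo : geometry a b p g gi) by now split.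
    exists gi. split; [now apply geometry_inverse with p|].
    intros x Hx. pose proof (Hp _ (proj1 Hx)) as reg.
    destruct (H _ (proj1 Hx)) as [E1 [E2 [E3 [E4 [E5 [E6 E7]]]]]]. split.
    + intros j. rewrite (divergence2_eq _ _ _ _ _ geo _ _ HP HA) by assumption.
      rewrite faraday_div_residual, E6, E7 by assumption. ring.
    + apply (einstein_trace_reversed _ _ _ _ _ geo _ _ HP HA x Hx). intros i j.
      apply Rminus_diag_uniq. rewrite Ricci_residual, E1, E2, E3, E4, E5 by assumption.
      unfold invariant_form. ring.
Qed.

(** * The equations for f, m, N and the potentials *)

Definition twice (u : R -> R) (r : R) : Prop := ex_derive u r /\ ex_derive (Derive u) r.

Lemma smooth_twice a b u r : smooth_on a b u -> in_interval a b r -> twice u r.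
Proof. intros Hu Hr. split; [apply (Hu 1%nat r Hr)|apply (Hu 2%nat r Hr)]. Qed.

Lemma constant_on_interval a b (u : R -> R) :
  (forall r, in_interval a b r -> is_derive u r 0) ->
  exists c, forall r, in_interval a b r -> u r = c.
Proof.
  intros Hu.
  assert (Hlt : forall r s, in_interval a b r -> in_interval a b s -> r < s -> u r = u s).
  { intros r s [Hr _] [_ Hs] Hrs. apply (eq_is_derive (u : R -> R_NormedModule)); [|assumption].
    intros t [Ht1 Ht2]. apply Hu. split.
    - now apply Rbar_lt_le_trans with r.
    - now apply Rbar_le_lt_trans with s. }
  (* The interval may be empty, in which case any constant serves. *)
  destruct (classic (exists r0, in_interval a b r0)) as [[r0 Hr0]|Hempty].
  - exists (u r0). intros r Hr. destruct (Rtotal_order r r0) as [?|[->|?]]; auto.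
    symmetry. auto.
  - exists 0. intros r Hr. now destruct Hempty; exists r.
Qed.

Definition ansatz_profile (f m N w : R -> R) : profile :=
  Profile f (fun r => m r / (4 * f r * N r)) (fun r => N r / m r) (fun r => m r / f r) w
    (fun r => Derive f r / (2 * f r))
    (fun r => / 2 * (Derive m r / m r - Derive f r / f r - Derive N r / N r))
    (fun r => / 2 * (Derive N r / N r - Derive m r / m r))
    (fun r => / 2 * (Derive m r / m r - Derive f r / f r))
    (Derive w).

Definition ansatz_gauge (w a0 q : R -> R) : potential :=
  Potential a0 q (fun r => Derive a0 r + w r * Derive q r) (Derive q).

Ltac contract_Derive :=
  repeat match goal with |- context [Derive (fun x => ?u x) ?r] =>
    progress change (Derive (fun x => u x) r) with (Derive u r) end.

Lemma ansatz_profile_regular f m N w r : 0 < f r -> 0 < m r -> 0 < N r ->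
  twice f r -> twice m r -> twice N r -> twice w r ->
  regular_profile (ansatz_profile f m N w) r.
Proof.
  intros Hf Hm HN [f1 f2] [m1 m2] [N1 N2] [w1 w2].
  assert (0 < f r * N r) by now apply Rmult_lt_0_compat.
  split; cbn.
  - assumption.
  - apply Rdiv_lt_0_compat; lra.
  - now apply Rdiv_lt_0_compat.
  - now apply Rdiv_lt_0_compat.
  - replace (2 * (Derive f r / (2 * f r)) * f r) with (Derive f r) by (field; lra).
    now apply Derive_correct.
  - auto_derive; [repeat split; trivial; lra|]. contract_Derive. field. repeat split; lra.
  - auto_derive; [repeat split; trivial; lra|]. contract_Derive. field. repeat split; lra.
  - auto_derive; [repeat split; trivial; lra|]. contract_Derive. field. repeat split; lra.
  - now apply Derive_correct.
  - auto_derive; repeat split; trivial; lra.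
  - auto_derive; repeat split; trivial; lra.
  - auto_derive; repeat split; trivial; lra.
  - auto_derive; repeat split; trivial; lra.
  - assumption.
Qed.

Lemma ansatz_gauge_regular f m N w a0 q r :
  twice w r -> twice a0 r -> twice q r ->
  regular_potential (ansatz_profile f m N w) (ansatz_gauge w a0 q) r.
Proof.
  intros [w1 w2] [a1 a2] [q1 q2]. split; cbn.
  - replace (_ - _) with (Derive a0 r) by ring. now apply Derive_correct.
  - now apply Derive_correct.
  - auto_derive. now repeat split.
  - assumption.
Qed.

(** The bracket equals (sigma - varpi dt)^2 + sin^2 th cos^2 th chi^2, and (m^2 - f N) / (m f) = m /
    f - N / m, so the total coefficient of sin^2 th cos^2 th chi^2 is m / f. *)
Lemma ansatz_metric_eq f m N w x i j : 0 < f (x cR) -> 0 < m (x cR) -> 0 < N (x cR) ->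
  ansatz_metric f m N w x i j = metric (ansatz_profile f m N w) i j (x cR) (x cth).
Proof.
  intros. pose proof (cos_sq (x cth)) as Hcos.
  unfold ansatz_metric, metric. cbn [gtt gRR gff gbb twist ansatz_profile].
  destruct i, j; components; trig_field Hcos.
Qed.

Lemma ansatz_potential_eq w a0 q x i :
  ansatz_potential a0 q x i = potential_form (ansatz_gauge w a0 q) i (x cR) (x cth).
Proof. reflexivity. Qed.

(** Gauss's law: for the ansatz [log_density] - 2 [log_t] is N'/N - f'/f, so N / f is an integrating
    factor. *)
Lemma charge_is_derive f m N w a0 q r : 0 < f r -> 0 < m r -> 0 < N r ->
  twice f r -> twice m r -> twice N r -> twice w r -> twice a0 r -> twice q r ->
  is_derive (fun y => N y / f y * (Derive a0 y + w y * Derive q y)) r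
    (N r / f r * residual_maxwell_t (ansatz_profile f m N w) (ansatz_gauge w a0 q) r).
Proof.
  intros Hf Hm HN [f1 f2] [m1 m2] [N1 N2] [w1 w2] [a1 a2] [q1 q2].
  unfold residual_maxwell_t, log_density; cbn.
  assert (HE : Derive (fun y => Derive a0 y + w y * Derive q y) r
    = Derive (Derive a0) r + Derive w r * Derive q r + w r * Derive (Derive q) r).
  { apply is_derive_unique. auto_derive; [now repeat split|]. contract_Derive. ring. }
  rewrite HE.
  auto_derive.
  - repeat split; trivial; lra.
  - contract_Derive. field. repeat split; lra.
Qed.

(** Here the coefficient of the twist derivative is 2 N'/N - f'/f - m'/m, with integrating factor
    N^2 / (f m). The charge law turns the electromagnetic source into the exact derivative 4 Q
    q'. *)
Lemma momentum_is_derive f m N w a0 q Q r : 0 < f r -> 0 < m r -> 0 < N r ->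
  twice f r -> twice m r -> twice N r -> twice w r -> twice a0 r -> twice q r ->
  N r / f r * (Derive a0 r + w r * Derive q r) = - Q ->
  is_derive (fun y => N y ^ 2 / (f y * m y) * Derive w y + 4 * Q * q y) r
    (N r ^ 2 / (f r * m r) * residual_tf (ansatz_profile f m N w) (ansatz_gauge w a0 q) r).
Proof.
  intros Hf Hm HN [f1 f2] [m1 m2] [N1 N2] [w1 w2] [a1 a2] [q1 q2] HQ.
  assert (0 < f r * m r) by now apply Rmult_lt_0_compat.
  (* The substituted value is taken at the fixed r, so it remains a constant under differentiation
     in y. *)
  replace Q with (- (N r / f r * (Derive a0 r + w r * Derive q r))) by lra.
  unfold residual_tf, log_density; cbn. auto_derive.
  - repeat split; trivial; lra.
  - contract_Derive. field. repeat split; lra.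
Qed.

Section Jets.
Variables (f m N w a0 q : R -> R) (Q J r : R).
Hypotheses (Hf : 0 < f r) (Hm : 0 < m r) (HN : 0 < N r).
Hypotheses (Df : twice f r) (Dm : twice m r) (DN : twice N r) (Dq : twice q r).

Lemma Derive_f_equation : Derive (fun y => m y / f y ^ 2 * Derive f y) r
  = Derive m r * Derive f r / f r ^ 2 - 2 * m r * Derive f r ^ 2 / f r ^ 3
    + m r * Derive (Derive f) r / f r ^ 2.
Proof.
  destruct Df, Dm. apply is_derive_unique. auto_derive.
  - repeat split; trivial. nra.
  - contract_Derive. field. lra.
Qed.

Lemma Derive_m_equation : Derive (fun y => N y / m y * Derive m y) r
  = Derive N r * Derive m r / m r - N r * Derive m r ^ 2 / m r ^ 2
    + N r * Derive (Derive m) r / m r.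
Proof.
  destruct Dm, DN. apply is_derive_unique. auto_derive.
  - repeat split; trivial. nra.
  - contract_Derive. field. lra.
Qed.

Lemma Derive_q_equation : Derive (fun y => m y * Derive q y) r
  = Derive m r * Derive q r + m r * Derive (Derive q) r.
Proof.
  destruct Dm, Dq. apply is_derive_unique. auto_derive.
  - repeat split; trivial.
  - contract_Derive. ring.
Qed.

Hypotheses (Hcharge : N r / f r * (Derive a0 r + w r * Derive q r) = - Q)
  (Hmomentum : N r ^ 2 / (f r * m r) * Derive w r + 4 * Q * q r = - 2 * J).

Let p := ansatz_profile f m N w.
Let P := ansatz_gauge w a0 q.

Definition equation_f : R :=
  f r ^ 2 * m r * Derive (fun y => m y / f y ^ 2 * Derive f y) r
   - m r * Derive m r * (Derive m r / m r - 2 * (Derive N r / N r)) * f r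
   - (4 * (m r ^ 2 / N r) - f r) * f r
   - (8 / 3 * (f r * m r / N r)
       * (2 * m r ^ 2 * Derive q r ^ 2 - f r * q r ^ 2)
     - 4 * Q ^ 2 / 3 * (f r ^ 2 * m r ^ 2 / N r ^ 2)).

Definition equation_m : R :=
  f r * m r * Derive (fun y => N y / m y * Derive m y) r
   + (f r ^ 2 * N r / m r ^ 2 - 2 * f r) * m r
   - (4 / 3 * f r * (2 * m r ^ 2 * Derive q r ^ 2 - f r * q r ^ 2)
     + 4 * Q ^ 2 / 3 * (f r ^ 2 * m r / N r)
     + 4 * (f r ^ 2 * m r ^ 2 / N r ^ 2) * (J + 2 * Q * q r) ^ 2).

Definition equation_q : R :=
  m r * Derive (fun y => m y * Derive q y) r - f r * q r
   - 2 * Q * (f r * m r ^ 2 / N r ^ 2) * (J + 2 * Q * q r).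

Let Hfm : 0 < f r * m r.
Proof. now apply Rmult_lt_0_compat. Qed.
Let HfN : 0 < f r * N r.
Proof. now apply Rmult_lt_0_compat. Qed.

Lemma electric_value : Derive a0 r + w r * Derive q r = - Q * f r / N r.
Proof. rewrite <- Hcharge. field. lra. Qed.

Lemma dtwist_value : Derive w r = - 2 * (J + 2 * Q * q r) * (f r * m r) / N r ^ 2.
Proof.
  replace (- 2 * (J + 2 * Q * q r)) with (- 2 * J - 4 * Q * q r) by ring.
  rewrite <- Hmomentum. field. lra.
Qed.

Lemma Derive_log_t : Derive (log_t p) r
  = Derive (Derive f) r / (2 * f r) - Derive f r ^ 2 / (2 * f r ^ 2).
Proof.
  destruct Df. apply is_derive_unique; cbn. auto_derive.
  - repeat split; trivial; lra.
  - contract_Derive. field. lra.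
Qed.

Lemma Derive_log_f : Derive (log_f p) r
  = / 2 * (Derive (Derive N) r / N r - Derive N r ^ 2 / N r ^ 2
           - Derive (Derive m) r / m r + Derive m r ^ 2 / m r ^ 2).
Proof.
  destruct Dm, DN. apply is_derive_unique; cbn. auto_derive.
  - repeat split; trivial; lra.
  - contract_Derive. field. lra.
Qed.

Lemma Derive_log_b : Derive (log_b p) r
  = / 2 * (Derive (Derive m) r / m r - Derive m r ^ 2 / m r ^ 2
           - Derive (Derive f) r / f r + Derive f r ^ 2 / f r ^ 2).
Proof.
  destruct Dm, Df. apply is_derive_unique; cbn. auto_derive.
  - repeat split; trivial; lra.
  - contract_Derive. field. lra.
Qed.

Ltac residuals :=
  unfold equation_f, equation_m, equation_q, constraint,
    residual_tt, residual_ff, residual_bb, residual_RR, residual_maxwell_f, faraday_norm2,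
    twist_energy, log_density;
  rewrite ?Derive_log_t, ?Derive_log_f, ?Derive_log_b,
    ?Derive_f_equation, ?Derive_m_equation, ?Derive_q_equation by assumption;
  unfold p, P;
  cbn [gtt gRR gff gbb twist log_t log_R log_f log_b dtwist ansatz_profile
       pot_t pot_f electric dpot_f ansatz_gauge];
  rewrite ?electric_value, ?dtwist_value;
  field; repeat split; lra.

(** In this sum the Maxwell, twist and Hopf curvature terms all cancel. Since the three logarithms
    add up to N'/(2N) and [log_density] is N'/N, only N and the curvature 4 of the base survive. *)
Lemma N_combination :
  2 * N r * (residual_tt p P r + residual_ff p P r + residual_bb p P r)
  = Derive (Derive N) r - 2.
Proof. residuals. Qed.

(** The bracket is twice the RR component of the residual of Einstein's equations before trace
    reversal. All second derivatives cancel in it, which makes it a constraint. *)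
Lemma constraint_combination : constraint f m N q Q J r
  = - (N r * m r / 2) *
    (residual_tt p P r + residual_ff p P r + 2 * residual_bb p P r + residual_RR p P r).
Proof. residuals. Qed.

Lemma f_combination : equation_f
  = 2 * f r * m r ^ 2 *
    (2 * residual_tt p P r + residual_ff p P r + 2 * residual_bb p P r + residual_RR p P r).
Proof. residuals. Qed.

Lemma m_combination : equation_m = 2 * f r * N r * m r * (residual_tt p P r + residual_bb p P r).
Proof. residuals. Qed.

Lemma q_combination : equation_q = m r ^ 2 * residual_maxwell_f p P r.
Proof. residuals. Qed.

End Jets.

Lemma second_order_equations_iff f m N q Q J r :
  second_order_equations f m N q Q J r
  <-> equation_f f m N q Q r = 0 /\ equation_m f m N q Q J r = 0 /\ equation_q f m N q Q J r = 0.
Proof.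
  unfold second_order_equations, equation_f, equation_m, equation_q.
  split; intros [E1 [E2 E3]]; repeat split; lra.
Qed.

(** The linear system inverts step by step: the f combination minus the constraint combination is
    the tt residual, the m combination then gives bb, the N combination ff, and the constraint RR.
    The remaining Maxwell residual is a multiple of [equation_q]. *)
Lemma ansatz_reduced_iff f m N w a0 q Q J r : 0 < f r -> 0 < m r -> 0 < N r ->
  twice f r -> twice m r -> twice N r -> twice q r ->
  N r / f r * (Derive a0 r + w r * Derive q r) = - Q ->
  N r ^ 2 / (f r * m r) * Derive w r + 4 * Q * q r = - 2 * J ->
  let p := ansatz_profile f m N w in let P := ansatz_gauge w a0 q in
  reduced p P r <->
  (residual_maxwell_t p P r = 0 /\ residual_tf p P r = 0) /\ Derive (Derive N) r = 2 /\
  second_order_equations f m N q Q J r /\ constraint f m N q Q J r = 0.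
Proof.
  intros Hf Hm HN Df Dm DN Dq HQ HJ p P.
  pose proof (N_combination f m N w a0 q Q J r Hf Hm HN Df Dm DN HQ HJ) as CN.
  pose proof (constraint_combination f m N w a0 q Q J r Hf Hm HN Df Dm DN HQ HJ) as CC.
  pose proof (f_combination f m N w a0 q Q J r Hf Hm HN Df Dm DN HQ HJ) as Cf.
  pose proof (m_combination f m N w a0 q Q J r Hf Hm HN Df Dm DN HQ HJ) as Cm.
  pose proof (q_combination f m N w a0 q Q J r Hf Hm HN Dm Dq HQ HJ) as Cq.
  fold p P in CN, CC, Cf, Cm, Cq. rewrite second_order_equations_iff.
  unfold reduced. split.
  - intros [E1 [E2 [E3 [E4 [E5 [E6 E7]]]]]].
    rewrite E1, E3, E4 in CN. rewrite Cf, Cm, Cq, CC, E1, E3, E4, E5, E7.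
    repeat split; lra.
  - intros [[E2 E6] [EN [[Ef [Em Eq]] EC]]].
    rewrite Ef in Cf. rewrite Em in Cm. rewrite Eq in Cq. rewrite EC in CC. rewrite EN in CN.
    assert (Hz : forall c t, 0 < c -> c * t = 0 -> t = 0).
    { intros c t Hc Ht. apply (Rmult_eq_reg_l c); lra. }
    assert (0 < f r * m r ^ 2) by (apply Rmult_lt_0_compat; [|apply pow_lt]; assumption).
    assert (0 < f r * N r * m r) by (repeat apply Rmult_lt_0_compat; assumption).
    assert (0 < N r * m r) by (apply Rmult_lt_0_compat; assumption).
    assert (ZN := Hz (2 * N r) _ ltac:(lra) (eq_trans CN (Rminus_diag_eq 2 2 eq_refl))).
    assert (Zf := Hz (2 * f r * m r ^ 2) _ ltac:(lra) (eq_sym Cf)).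
    assert (Zm := Hz (2 * f r * N r * m r) _ ltac:(lra) (eq_sym Cm)).
    assert (Zq := Hz (m r ^ 2) _ ltac:(now apply pow_lt) (eq_sym Cq)).
    assert (ZC : residual_tt p P r + residual_ff p P r + 2 * residual_bb p P r
                 + residual_RR p P r = 0).
    { apply (Hz (N r * m r)); lra. }
    repeat split; lra.
Qed.

(** * Propagation of the constraint and assembly of the theorem *)

Lemma constraint_is_derive f m N q Q J r : 0 < f r -> 0 < m r -> 0 < N r ->
  twice f r -> twice m r -> twice N r -> twice q r ->
  Derive (Derive N) r = 2 -> second_order_equations f m N q Q J r ->
  is_derive (fun y => constraint f m N q Q J y / f y ^ 2) r 0.
Proof.
  intros Hf Hm HN Df Dm DN Dq HN2 [Ef [Em Eq]].
  (* The second-order equations are solved for q'', f'' and m''. Substituting these and N'' = 2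
     turns the derivative of the quotient into a rational function of values and first derivatives,
     which vanishes identically. *)
  rewrite Derive_f_equation in Ef by assumption.
  rewrite Derive_m_equation in Em by assumption.
  rewrite Derive_q_equation in Eq by assumption.
  assert (Sq : Derive (Derive q) r
    = (f r * q r + 2 * Q * (f r * m r ^ 2 / N r ^ 2) * (J + 2 * Q * q r)
       - m r * Derive m r * Derive q r) / m r ^ 2).
  { rewrite <- Eq. field. lra. }
  assert (Sf : Derive (Derive f) r
    = (8 / 3 * (f r * m r / N r) * (2 * m r ^ 2 * Derive q r ^ 2 - f r * q r ^ 2)
       - 4 * Q ^ 2 / 3 * (f r ^ 2 * m r ^ 2 / N r ^ 2)
       + m r * Derive m r * (Derive m r / m r - 2 * (Derive N r / N r)) * f r
       + (4 * (m r ^ 2 / N r) - f r) * f r) / m r ^ 2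
      - Derive m r * Derive f r / m r + 2 * Derive f r ^ 2 / f r).
  { rewrite <- Ef. field. lra. }
  assert (Sm : Derive (Derive m) r
    = (4 / 3 * f r * (2 * m r ^ 2 * Derive q r ^ 2 - f r * q r ^ 2)
       + 4 * Q ^ 2 / 3 * (f r ^ 2 * m r / N r)
       + 4 * (f r ^ 2 * m r ^ 2 / N r ^ 2) * (J + 2 * Q * q r) ^ 2
       - (f r ^ 2 * N r / m r ^ 2 - 2 * f r) * m r) / (f r * N r)
      - Derive N r * Derive m r / N r + Derive m r ^ 2 / m r).
  { rewrite <- Em. field. lra. }
  clear Ef Em Eq. destruct Df, Dm, DN, Dq. unfold constraint. auto_derive.
  - repeat split; trivial; try lra; nra.
  - contract_Derive. rewrite Sf, Sm, Sq, HN2. field. lra.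
Qed.

(** Taking real parts gives a monic real quadratic whose other coefficients come from the real parts
    of the sum and the product of the roots. *)
Lemma complex_quadratic_Derive_n a b (N : R -> R) (z1 z2 : C) r :
  (forall x, in_interval a b x -> RtoC (N x) = ((RtoC x - z1) * (RtoC x - z2))%C) ->
  in_interval a b r -> Derive (Derive N) r = 2.
Proof.
  intros HN Hr.
  set (s := Re z1 + Re z2). set (t := Re z1 * Re z2 - Im z1 * Im z2).
  assert (HNr : forall x, in_interval a b x -> N x = x ^ 2 - s * x + t).
  { intros x Hx. pose proof (f_equal Re (HN x Hx)) as H.
    cbn in H. unfold s, t, Re, Im. rewrite H. ring. }
  assert (HD : forall x, in_interval a b x -> Derive N x = 2 * x - s).
  { intros x Hx. rewrite (Derive_ext_loc _ (fun y => y ^ 2 - s * y + t)).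
    - apply is_derive_unique. auto_derive; trivial. ring.
    - eapply filter_imp; [exact HNr|]. now apply in_interval_locally. }
  rewrite (Derive_ext_loc _ (fun y => 2 * y - s)).
  - apply is_derive_unique. auto_derive; trivial. ring.
  - eapply filter_imp; [exact HD|]. now apply in_interval_locally.
Qed.

Lemma is_derive_const_on a b (u : R -> R) c l r :
  (forall x, in_interval a b x -> u x = c) -> in_interval a b r -> is_derive u r l -> l = 0.
Proof.
  intros Hu Hr Hl. rewrite <- (is_derive_unique _ _ _ Hl).
  rewrite (Derive_ext_loc _ (fun _ => c)); [apply Derive_const|].
  eapply filter_imp; [exact Hu|]. now apply in_interval_locally.
Qed.

(* [rp2] and [rm2] are complex, as the general solution of N'' = 2 requires;
   real constants are a special case. *)
Theorem mainTheorem1 (a b : Rbar) (f m N varpi a0 aphi : R -> R)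
    (f_smooth : smooth_on a b f) (m_smooth : smooth_on a b m)
    (N_smooth : smooth_on a b N) (varpi_smooth : smooth_on a b varpi)
    (a0_smooth : smooth_on a b a0) (aphi_smooth : smooth_on a b aphi)
    (pos : forall x, in_interval a b x -> 0 < x /\ 0 < f x /\ 0 < m x /\ 0 < N x) :
  (einstein_maxwell (ansatz_domain a b)
     (ansatz_metric f m N varpi) (ansatz_potential a0 aphi)
   <->
   exists Q J : R, forall x, in_interval a b x ->
     conservation_laws f m N varpi a0 aphi Q J x /\
     second_order_equations f m N aphi Q J x /\
     constraint f m N aphi Q J x = 0)
  /\
  (forall rp2 rm2 : C,
     (forall x, in_interval a b x ->
        RtoC (N x) = ((RtoC x - rp2) * (RtoC x - rm2))%C) ->
   forall Q J : R,
     (forall x, in_interval a b x -> second_order_equations f m N aphi Q J x) ->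
   forall x, in_interval a b x ->
     is_derive (fun y => constraint f m N aphi Q J y / f y ^ 2) x 0).
Proof.
  pose proof (fun r => smooth_twice a b f r f_smooth) as Df.
  pose proof (fun r => smooth_twice a b m r m_smooth) as Dm.
  pose proof (fun r => smooth_twice a b N r N_smooth) as DN.
  pose proof (fun r => smooth_twice a b varpi r varpi_smooth) as Dw.
  pose proof (fun r => smooth_twice a b a0 r a0_smooth) as Da.
  pose proof (fun r => smooth_twice a b aphi r aphi_smooth) as Dq.
  split.
  - rewrite (einstein_maxwell_reduced a b (ansatz_profile f m N varpi)
      (ansatz_gauge varpi a0 aphi)).
    2: { intros r Hr. destruct (pos r Hr) as [_ [? [? ?]]].
         now apply ansatz_profile_regular; auto. }
    2: { intros r Hr. apply ansatz_gauge_regular; [apply Dw, Hr|apply Da, Hr|apply Dq, Hr]. }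
    2: { intros x i j [Hx _]. destruct (pos _ Hx) as [_ [? [? ?]]]. now apply ansatz_metric_eq. }
    2: { intros x i _. apply ansatz_potential_eq. }
    split.
    + intros H.
      destruct (constant_on_interval a b
        (fun y => N y / f y * (Derive a0 y + varpi y * Derive aphi y))) as [c Hc].
      { intros r Hr. destruct (pos r Hr) as [_ [? [? ?]]].
        evar_last; [apply charge_is_derive with (m := m); try assumption;
          [apply Df|apply Dm|apply DN|apply Dw|apply Da|apply Dq]; exact Hr|].
        destruct (H r Hr) as [_ [_ [_ [_ [_ [-> _]]]]]]. apply Rmult_0_r. }
      assert (HQ : forall r, in_interval a b r ->
        N r / f r * (Derive a0 r + varpi r * Derive aphi r) = - - c).
      { intros r Hr. rewrite Ropp_involutive. now apply Hc. }
      (* The second conserved quantity involves the charge Q = - c found first, so the constants are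
         obtained in this order. *)
      destruct (constant_on_interval a b
        (fun y => N y ^ 2 / (f y * m y) * Derive varpi y + 4 * - c * aphi y)) as [k Hk].
      { intros r Hr. destruct (pos r Hr) as [_ [? [? ?]]].
        evar_last; [apply momentum_is_derive with (a0 := a0); try assumption;
          [apply Df|apply Dm|apply DN|apply Dw|apply Da|apply Dq|apply HQ]; exact Hr|].
        destruct (H r Hr) as [_ [-> _]]. apply Rmult_0_r. }
      (* The signs and the factor come from the conservation laws, whose right-hand sides are - Q
         and - 2 J. *)
      exists (- c), (- k / 2). intros r Hr. destruct (pos r Hr) as [_ [? [? ?]]].
      assert (HJ : N r ^ 2 / (f r * m r) * Derive varpi r + 4 * - c * aphi r = - 2 * (- k / 2)).
      { rewrite Hk by assumption. lra. }
      destruct (proj1 (ansatz_reduced_iff f m N varpi a0 aphi (- c) (- k / 2) r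
        ltac:(assumption) ltac:(assumption) ltac:(assumption)
        (Df r Hr) (Dm r Hr) (DN r Hr) (Dq r Hr) (HQ r Hr) HJ) (H r Hr)) as [_ [HN2 HE]].
      repeat split; [exact HN2|now apply HQ|exact HJ|apply HE..].
    + intros [Q [J H]] r Hr. destruct (pos r Hr) as [_ [? [? ?]]].
      destruct (H r Hr) as [[HN2 [HQ HJ]] HE].
      apply (proj2 (ansatz_reduced_iff f m N varpi a0 aphi Q J r
        ltac:(assumption) ltac:(assumption) ltac:(assumption)
        (Df r Hr) (Dm r Hr) (DN r Hr) (Dq r Hr) HQ HJ)).
      split; [split|exact (conj HN2 HE)].
      (* The conservation laws hold on the whole interval with fixed Q and J. Hence their left-hand
         sides have derivative zero, and the nonvanishing integrating factors can be cancelled. *)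
      * apply (Rmult_eq_reg_l (N r / f r)).
        2: { now apply Rgt_not_eq, Rdiv_lt_0_compat. }
        rewrite Rmult_0_r.
        apply (is_derive_const_on a b
          (fun y => N y / f y * (Derive a0 y + varpi y * Derive aphi y)) (- Q) _ r); trivial.
        -- intros s Hs. apply (H s Hs).
        -- apply charge_is_derive; auto.
      * apply (Rmult_eq_reg_l (N r ^ 2 / (f r * m r))).
        2: { apply Rgt_not_eq, Rdiv_lt_0_compat; [now apply pow_lt|now apply Rmult_lt_0_compat]. }
        rewrite Rmult_0_r.
        apply (is_derive_const_on a b
          (fun y => N y ^ 2 / (f y * m y) * Derive varpi y + 4 * Q * aphi y) (- 2 * J) _ r);
          trivial.
        -- intros s Hs. apply (H s Hs).
        -- apply momentum_is_derive; auto.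
  - intros z1 z2 HN Q J HE r Hr. destruct (pos r Hr) as [_ [? [? ?]]].
    apply constraint_is_derive; auto.
    now apply (complex_quadratic_Derive_n a b N z1 z2).
Qed.
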